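(* Let $\alpha\in(0,1)$ and $\epsilon\in(0,1)$. For $p\in[0,1]$, let $X_1,X_2,\ldots$ be independent Bernoulli$(p)$ random variables under the probability measure $\mathbb{P}_p$, and let $S_n=\sum_{i=1}^n X_i$ for $n\in\mathbb{N}=\{1,2,\ldots\}$. Let $$\tau=\inf\left\{n\in\mathbb{N}:\ (n+1)\binom{n}{S_n}\alpha^{S_n}(1-\alpha)^{n-S_n}\leq\epsilon\right\}$$ (with $\inf\emptyset=\infty$), and define the estimator $$\hat p_{\mathrm{c}}=\begin{cases} S_\tau/\tau & \text{if }\tau<\infty,\\ \alpha & \text{if }\tau=\infty.\end{cases}$$ Then $$\sup_{p\in[0,1]}\mathrm{RR}_p(\hat p_{\mathrm{c}})<\epsilon,$$ where $\mathrm{RR}_p(\hat p_{\mathrm{c}})=\mathbb{P}_p(\hat p_{\mathrm{c}}>\alpha)$ if $p\leq\alpha$ and $\mathrm{RR}_p(\hat p_{\mathrm{c}})=\mathbb{P}_p(\hat p_{\mathrm{c}}\leq\alpha)$ if $p>\alpha$.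
   Context: The number $p$ is an unknown p-value, $\alpha$ is a fixed testing threshold, and $\epsilon$ is the desired bound on the resampling risk. The resampling risk $\mathrm{RR}_p(\hat p)$ of an estimator $\hat p$ of $p$ is the probability that the decision obtained by comparing $\hat p$ with $\alpha$ differs from the one obtained by comparing $p$ with $\alpha$: it equals $\mathbb{P}_p(\hat p>\alpha)$ if $p\leq\alpha$ and $\mathbb{P}_p(\hat p\leq\alpha)$ if $p>\alpha$. The stopping time $\tau$ is the one of the confidence sequence method (CSM): equivalently, $\tau=\inf\{n\in\mathbb{N}:\alpha\notin I_n\}$, where $I_n=\{q\in[0,1]:(n+1)\binom{n}{S_n}q^{S_n}(1-q)^{n-S_n}>\epsilon\}$. The definitions of $\tau$ and $\hat p_{\mathrm{c}}$ depend on $\alpha$, $\epsilon$ and the sequence $(X_i)$ only, not on $p$. *)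

(* Defs.v *)
From HB Require Import structures.
From mathcomp Require Import all_boot all_order all_algebra finmap.
From mathcomp Require Import all_classical all_reals all_analysis.

Set Implicit Arguments.
Unset Strict Implicit.
Unset Printing Implicit Defensive.

Import Order.TTheory GRing.Theory Num.Theory.

Local Open Scope classical_set_scope.
Local Open Scope ring_scope.

Definition mutually_independent d d' (T : measurableType d)
    (T' : measurableType d') (R : realType) (I : choiceType)
    (P : probability T R) (X : I -> {mfun T >-> T'}) : Prop :=
  forall (J : {fset I}) (B : I -> set T'),
    (forall i, i \in J -> measurable (B i)) ->
    P (\bigcap_(i in [set` J]) (X i @^-1` B i)) =
    (\prod_(i <- J) P (X i @^-1` B i))%E.

Definition bernoulli_RV d (T : measurableType d) (R : realType)
    (P : probability T R) (p : R) (X : {mfun T >-> bool}) : Prop :=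
  forall A : set bool, distribution P X A = bernoulli_prob p A.

(* The sequence is indexed from 0: [x i] stands for the observation X_{i+1}, *)
(* so that [successes x n] is S_n = X_1 + ... + X_n.                         *)
Definition successes (x : nat -> bool) (n : nat) : nat :=
  (\sum_(i < n) x i)%N.

Section csm.
Context {R : realType}.
Implicit Types (alpha eps : R) (x : nat -> bool).

Definition csm_stop alpha eps x (n : nat) : bool :=
  (0 < n)%N &&
  (n.+1%:R * 'C(n, successes x n)%:R * alpha ^+ successes x n
     * (1 - alpha) ^+ (n - successes x n) <= eps).

(* [None] is the value infinity, the infimum of the empty set. *)
Definition csm_tau alpha eps x : option nat :=
  match pselect (exists n, csm_stop alpha eps x n) with
  | left ex_stop => Some (ex_minn ex_stop)
  | right _ => None
  end.

Definition csm_estimator alpha eps x : R :=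
  if csm_tau alpha eps x is Some n then (successes x n)%:R / n%:R else alpha.

End csm.

Definition resampling_risk d (T : measurableType d) (R : realType)
    (alpha : R) (P : probability T R) (p : R) (phat : T -> R) : \bar R :=
  if p <= alpha then P [set w | alpha < phat w]
  else P [set w | phat w <= alpha].

(* Main.v *)
(* Mixing the Bernoulli(q) laws uniformly over q in [0, 1] gives every prefix
   of length n with k successes the weight k! (n - k)! / (n + 1)!, that is,
   ((n + 1) C(n, k))^-1, so the stopping rule says exactly that the alpha-weight
   of the observed prefix is at most eps times its mixture weight. If the
   decision taken there is wrong for p, then alpha lies between p and k / n, so
   the p-weight is at most the alpha-weight: no coupling is needed to compare p
   with alpha. Summing over wrong stopping prefixes bounds the risk by eps times
   their total mixture weight, which misses at least 1 / (M + 1), the weight of a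
   constant sequence of length M that has stopped on the right side. For
   p > alpha the event tau = oo also counts as an error; it is null, as
   P_p(tau > n) <= (n + 1) / eps * rho^n with rho < 1 the Hellinger affinity of
   Bernoulli(p) and Bernoulli(alpha). *)
Require Import Defs.
From mathcomp Require Import all_boot all_order all_algebra finmap ring lra.
From mathcomp Require Import all_classical all_reals all_analysis.

Import Order.TTheory GRing.Theory Num.Theory numFieldNormedType.Exports.

Local Open Scope classical_set_scope.
Local Open Scope ring_scope.

(** * Path weights and their uniform mixture *)

(** [a] and [b] need not sum to 1: geometric means of Bernoulli path weights also have this form. *)
Definition path_weight {R : pzRingType} (a b : R) (s : seq bool) : R :=
  a ^+ count id s * b ^+ count negb s.

Lemma path_weight_rcons {R : comPzRingType} (a b : R) s c :
  path_weight a b (rcons s c) = path_weight a b s * (if c then a else b).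
Proof.
rewrite /path_weight -cats1 !count_cat !exprD /=.
by case: c => /=; rewrite !expr0 !expr1; ring.
Qed.

Lemma path_weight_ge0 {R : numDomainType} (a b : R) s :
  0 <= a -> 0 <= b -> 0 <= path_weight a b s.
Proof. by move=> a0 b0; rewrite mulr_ge0 ?exprn_ge0. Qed.

(* The integral of [q ^ k * (1 - q) ^ l] over [0, 1], for [k] successes and [l]
   failures in [s]. *)
Definition polya {R : realType} (s : seq bool) : R :=
  ((count id s)`! * (count negb s)`!)%:R / ((size s).+1)`!%:R.

Lemma size_count (s : seq bool) : size s = (count id s + count negb s)%N.
Proof. by rewrite -(count_predC id s). Qed.

Lemma polya_ge0 {R : realType} s : 0 <= polya s :> R.
Proof. by rewrite /polya divr_ge0. Qed.

(** With [k! l!] factored out, this is [(k + 1) + (l + 1) = k + l + 2]. It makes the mixture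
    harmonic on the tree of prefixes. *)
Lemma polya_rcons {R : realType} s :
  polya (rcons s true) + polya (rcons s false) = polya s :> R.
Proof.
rewrite /polya -!cats1 !count_cat !size_cat /= !addn1 !addn0 size_count.
set k := count id s; set l := count negb s.
rewrite [((k + l).+2)`!]factS [(k.+1)`!]factS [(l.+1)`!]factS.
have f0 : ((k + l).+1`!)%:R != 0 :> R by rewrite pnatr_eq0 -lt0n fact_gt0.
have n0 : ((k + l).+2)%:R != 0 :> R by rewrite pnatr_eq0.
rewrite !natrM -mulrDl.
have -> : k.+1%:R * (k`!)%:R * (l`!)%:R + (k`!)%:R * (l.+1%:R * (l`!)%:R) =
   (k + l).+2%:R * ((k`!)%:R * (l`!)%:R) :> R.
  by rewrite -!natr1 natrD; ring.
by rewrite -mulf_div divff // mul1r.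
Qed.

Lemma polyaE {R : realType} s :
  polya s = ((size s).+1%:R * 'C(size s, count id s)%:R)^-1 :> R.
Proof.
have kn : (count id s <= size s)%N := count_size _ _.
rewrite /polya factS -(bin_fact kn).
have -> : (size s - count id s = count negb s)%N by rewrite size_count addKn.
rewrite !natrM.
have k0 : (count id s)`!%:R != 0 :> R by rewrite pnatr_eq0 -lt0n fact_gt0.
have l0 : (count negb s)`!%:R != 0 :> R by rewrite pnatr_eq0 -lt0n fact_gt0.
have c0 : 'C(size s, count id s)%:R != 0 :> R by rewrite pnatr_eq0 -lt0n bin_gt0.
have n0 : (size s).+1%:R != 0 :> R by rewrite pnatr_eq0.
field.
by rewrite k0 l0 c0 addrC natr1 n0.
Qed.

Lemma polya_nseq {R : realType} n b : polya (nseq n b) = n.+1%:R^-1 :> R.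
Proof.
rewrite polyaE size_nseq count_nseq; case: b => /=.
  by rewrite mul1n binn mulr1.
by rewrite mul0n bin0 mulr1.
Qed.

(** * The stopping rule on finite prefixes, and two analytic estimates *)

Lemma successesE x n : successes x n = count id (mkseq x n).
Proof.
elim: n => [|n IHn]; first by rewrite /successes big_ord0.
rewrite mkseqS -cats1 count_cat /= addn0 -IHn /successes big_ord_recr /=.
by [].
Qed.

Lemma mkseq_nth_take (x : nat -> bool) m n : (m <= n)%N ->
  mkseq (nth false (mkseq x n)) m = mkseq x m.
Proof.
move=> mn; apply/eq_in_map => i; rewrite mem_iota /= add0n => im.
by rewrite nth_mkseq // (leq_trans im).
Qed.

(** The rule at time [m] reads only the first [m] observations, so words padded with [false] can
    stand for infinite sequences. *)
Lemma csm_stop_prefix {R : realType} (alpha eps : R) x m n : (m <= n)%N ->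
  csm_stop alpha eps (nth false (mkseq x n)) m = csm_stop alpha eps x m.
Proof. by move=> mn; rewrite /csm_stop !successesE mkseq_nth_take. Qed.

Lemma csm_tauP {R : realType} (alpha eps : R) x n :
  csm_tau alpha eps x = Some n <->
  csm_stop alpha eps x n /\ forall m, csm_stop alpha eps x m -> (n <= m)%N.
Proof.
rewrite /csm_tau; case: pselect => [ex|nex].
  case: ex_minnP => k sk mink; split=> [[<-//]|[sn minn]].
  by congr Some; apply/eqP; rewrite eqn_leq mink // minn.
by split=> // -[sn _]; case: nex; exists n.
Qed.

Lemma csm_stop_polya {R : realType} (alpha eps : R) (s : seq bool) :
  csm_stop alpha eps (nth false s) (size s) ->
  path_weight alpha (1 - alpha) s <= eps * polya s.
Proof.
rewrite /csm_stop successesE mkseq_nth => /andP[_].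
rewrite polyaE ler_pdivlMr ?mulr_gt0 ?ltr0n ?bin_gt0 ?count_size //.
have -> : (size s - count id s = count negb s)%N by rewrite size_count addKn.
move=> ?.
by rewrite mulrC mulrA.
Qed.

(* The hypothesis says that [alpha] lies between [p] and the frequency of [s].
   Bounding both likelihood ratios by [x <= exp (x - 1)], the exponents add up
   to [(p - alpha) (k - n alpha) / (alpha (1 - alpha)) <= 0]. *)
Lemma path_weight_le_between {R : realType} (p alpha : R) (s : seq bool) :
  0 <= p <= 1 -> 0 < alpha < 1 ->
  (p - alpha) * ((count id s)%:R - (size s)%:R * alpha) <= 0 ->
  path_weight p (1 - p) s <= path_weight alpha (1 - alpha) s.
Proof.
move=> /andP[p0 p1] /andP[a0 a1] le0.
have b0 : 0 < 1 - alpha by rewrite subr_gt0.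
have le_exp (y : R) : y <= expR (y - 1).
  by have := expR_ge1Dx (y - 1); rewrite addrC subrK.
set k := count id s in le0; set l := count negb s.
have nE : (size s)%:R = k%:R + l%:R :> R by rewrite size_count natrD.
have x0 : 0 <= p / alpha by rewrite divr_ge0 // ltW.
have y0 : 0 <= (1 - p) / (1 - alpha) by rewrite divr_ge0 ?subr_ge0 // ltW.
suff : (p / alpha) ^+ k * ((1 - p) / (1 - alpha)) ^+ l <= 1.
  rewrite !expr_div_n mulf_div ler_pdivrMr ?mul1r //.
  by rewrite mulr_gt0 // exprn_gt0.
apply: (@le_trans _ _ (expR (p / alpha - 1) ^+ k *
                      expR ((1 - p) / (1 - alpha) - 1) ^+ l)).
  by apply: ler_pM; rewrite ?exprn_ge0 // lerXn2r ?nnegrE ?expR_ge0 ?le_exp.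
rewrite -!expRM_natl -expRD -[leRHS]expR0 ler_expR.
have -> : k%:R * (p / alpha - 1) + l%:R * ((1 - p) / (1 - alpha) - 1) =
    (p - alpha) * (k%:R - (size s)%:R * alpha) / (alpha * (1 - alpha)).
  by rewrite nE; field; rewrite !gt_eqF.
by rewrite pmulr_lle0 // invr_gt0 mulr_gt0.
Qed.

(** With [t = sqrt r], [(n + 1) t^n <= 1 + t + ... + t^n <= 1 / (1 - t)], and a second factor [t^n]
    tends to 0. *)
Lemma cvg_natmul_expr0 {R : realType} (r : R) : 0 <= r < 1 ->
  (n.+1%:R * r ^+ n) @[n --> \oo] --> 0.
Proof.
move=> /andP[r0 r1].
pose t := Num.sqrt r.
have t0 : 0 <= t := sqrtr_ge0 r.
have rE : r = t ^+ 2 by rewrite sqr_sqrtr.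
have t1 : t < 1 by rewrite -(ltr_pXn2r (n := 2)) ?nnegrE // -rE expr1n.
have nt n : n.+1%:R * t ^+ n <= (1 - t)^-1.
  rewrite -[leRHS]mul1r ler_pdivlMr ?subr_gt0 //.
  apply: (@le_trans _ _ ((\sum_(i < n.+1) t ^+ i) * (1 - t))).
    rewrite ler_wpM2r ?subr_ge0 ?(ltW t1) //.
    rewrite -{1}[n.+1]card_ord mulr_natl -sumr_const ler_sum // => i _.
    by rewrite ler_wiXn2l // ?(ltW t1) // -ltnS.
  rewrite mulrC -[_ * _]opprK -mulNr opprB -subrX1 opprB.
  by rewrite gerBl exprn_ge0.
apply: (@squeeze_cvgr _ _ _ _ (fun=> 0) (fun n => (1 - t)^-1 * t ^+ n)).
- near=> n; rewrite mulr_ge0 ?exprn_ge0 //=.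
  by rewrite rE -exprM mul2n -addnn exprD mulrA ler_wpM2r ?exprn_ge0.
- exact: cvg_cst.
- rewrite -[X in _ --> X](mulr0 (1 - t)^-1); apply: cvgMr.
  by apply: cvg_expr; rewrite ger0_norm.
Unshelve. all: by end_near. Qed.


(** * Cylinder events and their probabilities *)

Definition prefix_of {T : Type} (X : nat -> T -> bool) (w : T) n : seq bool :=
  mkseq (fun i => X i w) n.

Definition cylinder {T : Type} (X : nat -> T -> bool) (s : seq bool) : set T :=
  [set w | prefix_of X w (size s) = s].

(** Induction on [n], splitting on the last observation; [G] is arbitrary so that the hypothesis
    applies to [G (rcons _ b)]. *)
Lemma measurable_prefix {d} {T : measurableType d} (X : nat -> {mfun T >-> bool})
    (G : seq bool -> Prop) n : measurable [set w | G (prefix_of X w n)].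
Proof.
elim: n G => [|n IHn] G.
  have [g|ng] := pselect (G [::]).
    by rewrite (_ : mkset _ = setT)//; apply/seteqP; split.
  by rewrite (_ : mkset _ = set0)//; apply/seteqP; split.
pose B b := X n @^-1` [set b] `&` [set w | G (rcons (prefix_of X w n) b)].
have mB b : measurable (B b).
  apply: measurableI; last exact: (IHn (fun s => G (rcons s b))).
  by rewrite -[X in measurable X]setTI; exact: (measurable_funPT (X n)).
rewrite (_ : mkset _ = B true `|` B false); first exact: measurableU.
apply/seteqP; split => w /=; rewrite /prefix_of mkseqS /B /=.
  by case: (X n w) => Gw; [left|right].
by case=> -[/= ->].
Qed.

Lemma measurable_cylinder {d} {T : measurableType d} (X : nat -> {mfun T >-> bool}) s :
  measurable (cylinder X s).
Proof. exact: (measurable_prefix X (fun t => t = s)). Qed.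

Lemma cylinder_rcons {T : Type} (X : nat -> T -> bool) s :
  cylinder X s = cylinder X (rcons s true) `|` cylinder X (rcons s false).
Proof.
apply/seteqP; split=> w; rewrite /cylinder /prefix_of /= !size_rcons !mkseqS.
  by move=> ->; case: (X (size s) w); [left|right].
by case=> /rcons_inj [].
Qed.

Lemma probability_cylinder {R : realType} {d} {T : measurableType d}
    (P : probability T R) (X : nat -> {mfun T >-> bool}) (p : R) s :
  0 <= p <= 1 -> (forall i, bernoulli_RV P p (X i)) ->
  mutually_independent P X ->
  P (cylinder X s) = (path_weight p (1 - p) s)%:E.
Proof.
move=> p01 hb hi.
pose J := [fset i | i in iota 0 (size s)]%fset.
have memJ i : (i \in J) = (i < size s)%N.
  apply/imfsetP/idP => [[j /=]|i_lt].
    by rewrite mem_iota /= add0n => j_lt ->.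
  by exists i => //=; rewrite mem_iota.
have := hi J (fun i => [set nth false s i]) (fun _ _ => I).
rewrite (_ : \bigcap_(i in _) _ = cylinder X s); last first.
  apply/seteqP; split=> w /=.
    move=> Hw; apply: (@eq_from_nth _ false); first by rewrite size_mkseq.
    move=> i; rewrite size_mkseq => i_lt; rewrite nth_mkseq //.
    by apply: Hw; rewrite /= memJ.
  rewrite /cylinder /= => Hw i /=; rewrite memJ => i_lt.
  by rewrite -Hw nth_mkseq.
move=> ->.
have XE i : P (X i @^-1` [set nth false s i]) =
    (if nth false s i then p else 1 - p)%:E.
  rewrite -[LHS]/(distribution P (X i) _) hb bernoulli_probE // !diracE.
  case: (nth false s i); rewrite !classical_sets.in_set1 !eqE /=.
    by rewrite mule1 mule0 adde0.
  by rewrite mule0 mule1 add0e.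
under eq_bigr do rewrite XE.
rewrite prodEFin; congr _%:E.
have permJ : perm_eq (enum_fset J) (iota 0 (size s)).
  apply: uniq_perm; rewrite ?iota_uniq ?fset_uniq // => i.
  by rewrite memJ mem_iota.
rewrite (perm_big _ permJ) /=.
rewrite -{1}(subn0 (size s)) -/(index_iota 0 (size s)).
rewrite -(big_nth false predT (fun b : bool => if b then p else 1 - p)).
elim: s {J memJ XE permJ} => [|b s IHs]; first by rewrite big_nil /path_weight !expr0 mulr1.
rewrite big_cons IHs /path_weight /=.
by case: b; rewrite /= ?add1n ?add0n exprS; ring.
Qed.

(** * Tree induction and stopping events *)

(** Backward induction from depth [N]. At each node satisfying the invariant [I], either [h] already
    bounds the mass of [A], or the budget [h s] pays for both children; at depth [N] only the former
    is possible. *)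
Lemma tree_bound {R : realType} {d} {T : measurableType d}
    (P : probability T R) (X : nat -> {mfun T >-> bool}) (A : set T)
    (I : seq bool -> Prop) (h : seq bool -> R) (N : nat) :
  measurable A -> I [::] ->
  (forall s, (size s <= N)%N -> I s ->
     (P (A `&` cylinder X s) <= (h s)%:E)%E \/
     [/\ (size s < N)%N, h (rcons s true) + h (rcons s false) <= h s
       & forall b, I (rcons s b)]) ->
  (P A <= (h [::])%:E)%E.
Proof.
move=> mA I0 step.
suff H m s : (size s + m)%N = N -> I s -> (P (A `&` cylinder X s) <= (h s)%:E)%E.
  have := H N [::] (add0n N) I0.
  by rewrite (_ : cylinder X [::] = setT) ?setIT //; apply/seteqP; split.
elim: m s => [|m IHm] s sN Is.
  case: (step s _ Is) => //; first by rewrite -sN leq_addr.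
  by case; rewrite -sN addn0 ltnn.
case: (step s _ Is) => //; first by rewrite -sN leq_addr.
case=> _ hs Ir.
rewrite cylinder_rcons setIUr.
have mC b : measurable (A `&` cylinder X (rcons s b)).
  by apply: measurableI => //; exact: measurable_cylinder.
apply: (le_trans (measureU2 _ (mC true) (mC false))).
have HC b : (P (A `&` cylinder X (rcons s b)) <= (h (rcons s b))%:E)%E.
  by apply: IHm => //; rewrite size_rcons addSnnS.
by apply: (le_trans (leeD (HC true) (HC false))); rewrite -EFinD lee_fin.
Qed.

(** [bad] is left abstract so that errors on either side of [alpha] share one treatment. *)
Definition csm_stopped {R : realType} {T : Type} (alpha eps : R)
    (X : nat -> T -> bool) (bad : nat -> nat -> Prop) n : set T :=
  [set w | csm_tau alpha eps (X^~ w) = Some n /\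
           bad n (successes (X^~ w) n)].

Lemma measurable_csm_stopped {R : realType} {d} {T : measurableType d}
    (alpha eps : R) (X : nat -> {mfun T >-> bool}) bad n :
  measurable (csm_stopped alpha eps X bad n).
Proof.
pose G s := [/\ csm_stop alpha eps (nth false s) n,
  forall m, (m < n)%N -> ~~ csm_stop alpha eps (nth false s) m &
  bad n (count id s)].
rewrite (_ : csm_stopped _ _ _ _ _ = [set w | G (prefix_of X w n)]).
  exact: measurable_prefix.
apply/seteqP; split => w; rewrite /csm_stopped /G /= csm_tauP successesE.
  move=> [[sn minn] bn]; split => //; first by rewrite csm_stop_prefix.
  move=> m mn; rewrite csm_stop_prefix 1?ltnW//.
  by apply/negP => /minn; rewrite leqNgt mn.
move=> [sn minn bn]; split => //; split.
  by move: sn; rewrite csm_stop_prefix.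
move=> m; apply: contraTT; rewrite -ltnNge => mn.
by have := minn _ mn; rewrite csm_stop_prefix 1?ltnW.
Qed.

(* Optional stopping in tree form: [h] dominates the path weights at bad stopping
   nodes and is superharmonic at the other ones. *)
Lemma csm_stopped_bound {R : realType} {d} {T : measurableType d}
    (P : probability T R) (X : nat -> {mfun T >-> bool}) (p alpha eps : R)
    (bad : nat -> nat -> Prop) (h : seq bool -> R) :
  (forall s, P (cylinder X s) = (path_weight p (1 - p) s)%:E) ->
  (forall s, 0 <= h s) ->
  (forall s, csm_stop alpha eps (nth false s) (size s) ->
     bad (size s) (count id s) -> path_weight p (1 - p) s <= h s) ->
  (forall s, ~~ csm_stop alpha eps (nth false s) (size s) ->
     h (rcons s true) + h (rcons s false) <= h s) ->
  forall N, (P (\big[setU/set0]_(n < N) csm_stopped alpha eps X bad n) <=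
             (h [::])%:E)%E.
Proof.
move=> PC h0 hstop hcont N; set A := \big[_/_]_(_ < _) _.
have mA : measurable A.
  by apply: bigsetU_measurable => n _; exact: measurable_csm_stopped.
(* No strict prefix of [s] has stopped; hence [tau >= size s] on the cylinder of [s]. *)
pose I s := forall m, (m < size s)%N -> ~~ csm_stop alpha eps (nth false s) m.
apply: (@tree_bound _ _ _ P X A I h N) => // s sN Is.
have tauP w n : cylinder X s w -> csm_tau alpha eps (X^~ w) = Some n ->
    (size s <= n)%N.
  rewrite /cylinder /= => ws /csm_tauP [sn _]; rewrite leqNgt; apply/negP => ns.
  by have := Is _ ns; rewrite -ws csm_stop_prefix 1?ltnW// sn.
have sub (B : set T) : measurable B -> A `&` cylinder X s `<=` B ->
    (P (A `&` cylinder X s) <= P B)%E.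
  move=> mB AB; apply: le_measure => //; rewrite inE //.
  by apply: measurableI => //; exact: measurable_cylinder.
have null : A `&` cylinder X s `<=` set0 -> (P (A `&` cylinder X s) <= (h s)%:E)%E.
  move=> /(sub _ measurable0); rewrite measure0 => /le_trans; apply.
  by rewrite lee_fin.
have memA w : A w -> exists2 n, (n < N)%N & csm_stopped alpha eps X bad n w.
  rewrite /A -bigcup_mkord => -[n /= nN An]; by exists n.
case: (boolP (csm_stop alpha eps (nth false s) (size s))) => [ss|nss].
  left; have tauE w n : cylinder X s w ->
      csm_tau alpha eps (X^~ w) = Some n -> n = size s.
    move=> Cw tw; apply/eqP; rewrite eqn_leq (tauP w) // andbT.
    move/csm_tauP: tw => [_]; apply.
    by move: ss; rewrite -{1}Cw csm_stop_prefix.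
  have [b|nb] := pselect (bad (size s) (count id s)).
    apply: (le_trans (sub _ (measurable_cylinder X s) (@subIsetr _ _ _))).
    by rewrite PC lee_fin; exact: hstop.
  apply: null => w [/memA [n _ [tw bw]] Cw].
  have CwE : mkseq (X^~ w) (size s) = s := Cw.
  by move: bw; rewrite successesE (tauE w n) // CwE.
(* At depth [N] nothing of [A] is left, since [A] requires [tau < N]. *)
move: sN; rewrite leq_eqVlt => /orP[/eqP sN|sN].
  left; apply: null => w [/memA [n nN [tw bw]] Cw].
  by have := tauP _ _ Cw tw; rewrite sN leqNgt nN.
right; split => //; first exact: hcont.
move=> b m; rewrite size_rcons ltnS leq_eqVlt => ms.
have nthE k : (k <= size s)%N ->
    csm_stop alpha eps (nth false (rcons s b)) k = csm_stop alpha eps (nth false s) k.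
  move=> ks; rewrite /csm_stop !successesE.
  have -> // : mkseq (nth false (rcons s b)) k = mkseq (nth false s) k.
  apply/eq_in_map => i; rewrite mem_iota /= add0n => ik.
  by rewrite nth_rcons (leq_trans ik).
case/orP: ms => [/eqP ->|ms]; first by rewrite nthE.
by rewrite nthE 1?ltnW//; exact: Is.
Qed.


(** * The one-sided error bound *)

Lemma mkseq_const (b : bool) n : mkseq (fun=> b) n = nseq n b.
Proof.
apply: (@eq_from_nth _ b); rewrite size_mkseq ?size_nseq // => i ni.
by rewrite nth_mkseq // nth_nseq ni.
Qed.

Lemma count_id_nseq (b : bool) n : count id (nseq n b) = (if b then n else 0)%N.
Proof. by rewrite count_nseq; case: b; rewrite /= ?mul1n ?mul0n. Qed.

(** The constant sequence [b] is on the correct side; its mixture weight at time [M] is the gain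
    that makes the bound strictly smaller than [eps]. *)
Lemma csm_one_sided_bound {R : realType} {d} {T : measurableType d}
    (P : probability T R) (X : nat -> {mfun T >-> bool}) (p alpha eps : R)
    (bad : nat -> nat -> Prop) (b : bool) (M : nat) :
  0 <= p <= 1 -> 0 < alpha < 1 -> 0 < eps ->
  (forall s, P (cylinder X s) = (path_weight p (1 - p) s)%:E) ->
  csm_stop alpha eps (fun=> b) M ->
  (forall n k, (0 < n)%N -> bad n k -> (p - alpha) * (k%:R - n%:R * alpha) <= 0) ->
  (forall n, (0 < n)%N -> ~ bad n (if b then n else 0)%N) ->
  forall N, (P (\big[setU/set0]_(n < N) csm_stopped alpha eps X bad n) <=
             (eps * (1 - M.+1%:R^-1))%:E)%E.
Proof.
move=> p01 a01 e0 PC stopM badP nbad.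
(* [c] is the mixture weight carried to each node by the constant path of
   length [M], which may be discarded because that path never stops badly. *)
pose c s : R := if (s == nseq (size s) b) && (size s <= M)%N then M.+1%:R^-1 else 0.
pose h s := eps * (polya s - c s).
have c0 s : 0 <= c s by rewrite /c; case: ifP.
rewrite (_ : 1 - _ = polya [::] - c [::]); last first.
  by rewrite /c /= /polya /= fact0 mul1n divr1.
apply: (@csm_stopped_bound _ _ _ P X p alpha eps bad h) => //.
(* On the constant path, [polya s = 1 / (size s + 1) >= 1 / (M + 1)]. *)
- move=> s; rewrite mulr_ge0 ?(ltW e0) // subr_ge0 /c.
  case: ifP => [/andP[/eqP -> sM]|_]; last exact: polya_ge0.
  by rewrite size_nseq in sM *; rewrite polya_nseq lef_pV2 ?posrE ?ltr0n // ler_nat.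
- move=> s stops bads.
  have n0 : (0 < size s)%N by case/andP: stops.
  rewrite /h (_ : c s = 0) ?subr0; last first.
    rewrite /c; case: ifP => // /andP[/eqP sE _]; exfalso.
    by apply: (nbad _ n0); move: bads; rewrite {2}sE count_id_nseq.
  apply: le_trans (csm_stop_polya _ _ _ stops).
  by apply: path_weight_le_between => //; exact: badP.
(* The mixture terms cancel exactly, leaving [c s <= c (rcons s true) + c (rcons s false)]. *)
- move=> s nstop; rewrite -mulrDr ler_pM2l // addrACA polya_rcons lerD2l -opprD lerN2.
  rewrite {1}/c; case: ifP => [/andP[/eqP sE sM]|_]; last exact: addr_ge0.
  (* The constant word of length [M] satisfies the rule, whereas [s] does not, so the path continues
     within length [M]. *)
  have {}sM : (size s < M)%N.
    rewrite ltn_neqAle sM andbT; apply: contraNneq nstop => sME.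
    by rewrite sE size_nseq -mkseq_const csm_stop_prefix // sME.
  suff cb : c (rcons s b) = M.+1%:R^-1.
    by case: (b) cb => ->; rewrite ?lerDl ?lerDr.
  by rewrite /c size_rcons sM andbT {1}sE -[X in rcons X]mkseq_const -mkseqS mkseq_const eqxx.
Qed.

(** On a constant sequence the tested quantity is [(n + 1) r^n] with [r < 1]. *)
Lemma csm_stop_const_eventually {R : realType} (alpha eps : R) (b : bool) :
  0 < alpha < 1 -> 0 < eps ->
  \forall n \near \oo, csm_stop alpha eps (fun=> b) n.
Proof.
move=> /andP[a0 a1] e0.
pose r := if b then alpha else 1 - alpha.
have r01 : 0 <= r < 1.
  by rewrite /r; case: (b); rewrite ?(ltW a0) ?a1 // subr_ge0 (ltW a1) ltrBlDr ltrDl.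
have /cvgr_le /(_ _ e0) := cvg_natmul_expr0 _ r01.
move=> le_e; near=> n; rewrite /csm_stop; apply/andP; split; first by near: n; exists 1%N.
rewrite successesE mkseq_const count_id_nseq.
have : n.+1%:R * r ^+ n <= eps by near: n.
rewrite /r; case: (b) => /=.
  by rewrite binn subnn expr0 !mulr1.
by rewrite bin0 subn0 expr0 !mulr1.
Unshelve. all: by end_near. Qed.

(** * Decay of the probability of not stopping *)

(** This is one term of the expansion of [((1 - p) + p)^n = 1]. *)
Lemma binomial_weight_le1 {R : realType} (p : R) (s : seq bool) : 0 <= p <= 1 ->
  'C(size s, count id s)%:R * path_weight p (1 - p) s <= 1.
Proof.
move=> /andP[p0 p1].
have kn : (count id s < (size s).+1)%N by rewrite ltnS count_size.
apply: (@le_trans _ _ ((1 - p + p) ^+ size s)); last by rewrite subrK expr1n.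
rewrite exprDn.
rewrite (bigD1 (Ordinal kn)) //=.
have -> : (size s - count id s = count negb s)%N by rewrite size_count addKn.
rewrite /path_weight mulr_natl [X in X *+ _]mulrC lerDl.
by rewrite sumr_ge0 // => i _; rewrite mulrn_wge0 // mulr_ge0 // exprn_ge0 ?subr_ge0.
Qed.

(* Since [csm_stop] fails, the [alpha]-weight of [s] dominates its [p]-weight
   up to a factor [(n + 1) / eps]; hence so does their geometric mean. *)
Lemma csm_not_stop_weight {R : realType} (p alpha eps : R) (s : seq bool) :
  0 <= p <= 1 -> 0 < alpha < 1 -> 0 < eps < 1 -> (0 < size s)%N ->
  ~~ csm_stop alpha eps (nth false s) (size s) ->
  path_weight p (1 - p) s <= (size s).+1%:R / eps *
    path_weight (Num.sqrt (p * alpha)) (Num.sqrt ((1 - p) * (1 - alpha))) s.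
Proof.
move=> p01 a01 /andP[e0 e1] n0; have /andP[p0 p1] := p01; have /andP[a0 a1] := a01.
rewrite /csm_stop n0 successesE mkseq_nth -ltNge.
rewrite (_ : (size s - count id s = count negb s)%N); last by rewrite size_count addKn.
rewrite -[X in _ < X]mulrA -/(path_weight alpha (1 - alpha) s).
have := binomial_weight_le1 p s p01.
set C := 'C(_, _)%:R; set n := (size s).+1%:R.
set v := path_weight alpha _ s; set w := path_weight p _ s => Cw ltv.
set u := path_weight (Num.sqrt _) _ s.
have n1 : 1 <= n by rewrite /n ler1n.
have w0 : 0 <= w by apply: path_weight_ge0; lra.
have v0 : 0 <= v by apply: path_weight_ge0; lra.
have u0 : 0 <= u by apply: path_weight_ge0; exact: sqrtr_ge0.
have uE : u ^+ 2 = w * v.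
  rewrite /u /w /v /path_weight exprMn -!exprM ![(_ * 2)%N]mulnC !exprM.
  by rewrite !sqr_sqrtr ?mulr_ge0 ?subr_ge0 // ?(ltW a0) ?(ltW a1) // !exprMn; ring.
(* Failure of the rule gives [eps < n C v]; multiply by [w] and use [C w <= 1]. *)
have ew : w <= n / eps * v.
  rewrite mulrAC ler_pdivlMr // mulrC.
  apply: (@le_trans _ _ (n * C * v * w)); first by rewrite ler_wpM2r // ltW.
  rewrite (_ : n * C * v * w = n * v * (C * w)); last by ring.
  by rewrite -[leRHS]mulr1 ler_wpM2l // mulr_ge0 // ler0n.
have ne1 : 1 <= n / eps by rewrite ler_pdivlMr // mul1r; lra.
have ne0 : 0 <= n / eps by lra.
have nu0 : 0 <= n / eps * u by rewrite mulr_ge0.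
(* Compare squares: [w^2 <= (n / eps) w v <= (n / eps)^2 u^2], as [n / eps >= 1] and [u^2 = w v]. *)
rewrite -(ler_pXn2r (n := 2)) ?nnegrE // [leRHS]exprMn uE.
apply: (@le_trans _ _ (n / eps * (w * v))).
  by rewrite [leRHS](_ : _ = w * (n / eps * v)) 1?expr2 ?ler_wpM2l //; ring.
rewrite [leRHS](_ : _ = (n / eps) * (n / eps * (w * v))); last by ring.
by rewrite ler_peMl // mulr_ge0 // mulr_ge0.
Qed.

Lemma measurable_csm_stop {R : realType} {d} {T : measurableType d}
    (alpha eps : R) (X : nat -> {mfun T >-> bool}) n :
  measurable [set w | ~~ csm_stop alpha eps (X^~ w) n].
Proof.
rewrite (_ : mkset _ =
  [set w | ~~ csm_stop alpha eps (nth false (prefix_of X w n)) n]).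
  exact: (measurable_prefix X (fun s => ~~ csm_stop alpha eps (nth false s) n)).
by apply/seteqP; split => w /=; rewrite csm_stop_prefix.
Qed.

Lemma csm_not_stop_bound {R : realType} {d} {T : measurableType d}
    (P : probability T R) (X : nat -> {mfun T >-> bool}) (p alpha eps : R) N :
  0 <= p <= 1 -> 0 < alpha < 1 -> 0 < eps < 1 ->
  (forall s, P (cylinder X s) = (path_weight p (1 - p) s)%:E) ->
  (0 < N)%N ->
  (P [set w | ~~ csm_stop alpha eps (X^~ w) N] <=
   (N.+1%:R / eps * (Num.sqrt (p * alpha) + Num.sqrt ((1 - p) * (1 - alpha))) ^+ N)%:E)%E.
Proof.
move=> p01 a01 e01 PC N0.
set a := Num.sqrt (p * alpha); set b := Num.sqrt _; set A := [set _ | _].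
have mA : measurable A := measurable_csm_stop alpha eps X N.
(* Up to the prefactor, [h s] sums the geometric-mean weights of all extensions of [s] to length
   [N], so it is harmonic. *)
pose h s := N.+1%:R / eps * (path_weight a b s * (a + b) ^+ (N - size s)).
rewrite (_ : _ * _ = h [::]); last by rewrite /h /path_weight !expr0 !mul1r subn0.
apply: (@tree_bound _ _ _ P X A (fun=> True) h N) => // s.
rewrite leq_eqVlt => /orP[/eqP sN|sN] _; last first.
  right; split=> //; rewrite /h !size_rcons !path_weight_rcons -mulrDr -mulrDl -mulrDr.
  by rewrite -(subnSK sN) exprS !mulrA lexx.
left; rewrite /h sN subnn expr0 mulr1.
have mC := measurable_cylinder X s.
have [st|nst] := boolP (csm_stop alpha eps (nth false s) (size s)).
  rewrite (_ : A `&` _ = set0); last first.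
    apply/seteqP; split => w //= -[]; rewrite /A /cylinder /= => nA ws.
    by move: st nA; rewrite -{1}ws sN csm_stop_prefix // => ->.
  rewrite measure0 lee_fin mulr_ge0 //; last first.
    by apply: path_weight_ge0; exact: sqrtr_ge0.
  by rewrite divr_ge0 // ltW //; case/andP: e01.
apply: (@le_trans _ _ (P (cylinder X s))).
  by apply: le_measure; rewrite ?inE //; exact: measurableI.
rewrite PC lee_fin -sN; apply: csm_not_stop_weight => //.
by rewrite sN.
Qed.

(** Strict AM-GM for each root; the two arithmetic means add up to 1. *)
Lemma hellinger_affinity_lt1 {R : realType} (p q : R) :
  0 <= p <= 1 -> 0 <= q <= 1 -> p != q ->
  Num.sqrt (p * q) + Num.sqrt ((1 - p) * (1 - q)) < 1.
Proof.
have amgm (x y : R) : 0 <= x -> 0 <= y -> x != y -> Num.sqrt (x * y) < (x + y) / 2.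
  move=> x0 y0 xy; have m0 : 0 <= (x + y) / 2 by lra.
  rewrite -(ltr_pXn2r (n := 2)) ?nnegrE ?sqrtr_ge0 // sqr_sqrtr ?mulr_ge0 //.
  have : 0 < (x - y) ^+ 2 by rewrite exprn_even_gt0 //= subr_eq0.
  by rewrite !expr2; nra.
move=> /andP[p0 p1] /andP[q0 q1] pq.
have h1 := amgm p q p0 q0 pq.
have : Num.sqrt ((1 - p) * (1 - q)) < ((1 - p) + (1 - q)) / 2.
  by apply: amgm; rewrite ?subr_ge0 // (inj_eq (addrI 1)) eqr_opp.
by move=> h2; lra.
Qed.

(** * The bound uniform in [p] *)

(** Sequences that never stop get the value [alpha], which is not above [alpha], so only finite
    stopping times contribute. *)
Lemma csm_estimator_gtE {R : realType} {T : Type} (alpha eps : R) (X : nat -> T -> bool) :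
  [set w | alpha < csm_estimator alpha eps (X^~ w)] =
  \bigcup_n csm_stopped alpha eps X (fun n k => alpha < k%:R / n%:R) n.
Proof.
apply/seteqP; split => w /=; rewrite /csm_estimator.
  case E : csm_tau => [n|]; last by rewrite ltxx.
  by move=> H; exists n.
by move=> [n _ [-> ]].
Qed.

Theorem theorem1 (R : realType) (alpha eps : R)
    (halpha : 0 < alpha < 1) (heps : 0 < eps < 1)
    (d : measure_display) (T : measurableType d)
    (P : R -> probability T R) (X : nat -> {mfun T >-> bool})
    (hbern : forall p : R, 0 <= p <= 1 ->
       forall i : nat, bernoulli_RV (P p) p (X i))
    (hindep : forall p : R, 0 <= p <= 1 -> mutually_independent (P p) X) :
  (ereal_sup [set resampling_risk alpha (P p) p
                    (fun w => csm_estimator alpha eps (fun i => X i w))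
             | p in [set p : R | (0 <= p <= 1)%R]] < eps%:E)%E.
Proof.
have [/andP[a0 a1] /andP[e0 e1]] := (halpha, heps).
(* One [M] serves both constant sequences and every [p], so the strict inequality survives the
   supremum. *)
have [M [stopF stopT]] : exists M, csm_stop alpha eps (fun=> false) M /\
    csm_stop alpha eps (fun=> true) M.
  near \oo => M; exists M.
  by split; near: M; exact: csm_stop_const_eventually.
have M0 : 0 < M.+1%:R^-1 :> R by rewrite invr_gt0 ltr0n.
apply: (@le_lt_trans _ _ (eps * (1 - M.+1%:R^-1))%:E); last first.
  by rewrite lte_fin gtr_pMr // ltrBlDr ltrDl.
apply: ge_ereal_sup => _ [p /= p01 <-].
have PC s : P p (cylinder X s) = (path_weight p (1 - p) s)%:E.
  by apply: probability_cylinder => //; [exact: hbern|exact: hindep].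
have mup n := measurable_csm_stopped alpha eps X (fun n k => alpha < k%:R / n%:R) n.
rewrite /resampling_risk; case: ifPn => [pa|]; last rewrite -ltNge => pa.
  (* Continuity from below reduces the risk to errors made by a finite time; the all-failures path
     never errs here. *)
  rewrite csm_estimator_gtE -bigcup_bigsetU_bigcup.
  pose F N : set T := \big[setU/set0]_(n < N.+1)
    csm_stopped alpha eps X (fun n k => alpha < k%:R / n%:R) n.
  rewrite -/(\bigcup_N F N).
  have mF n : measurable (F n) by apply: bigsetU_measurable => i _; exact: mup.
  have /cvg_lim <- // : (P p \o F) x @[x --> \oo] --> P p (\bigcup_n F n).
    apply: nondecreasing_cvg_mu => //; first exact: bigcup_measurable.
    by move=> m n mn; apply/subsetPset; exact: subset_bigsetU.
  apply: lime_le.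
    apply: ereal_nondecreasing_is_cvgn => m n mn; apply: le_measure; rewrite ?inE //.
    exact: subset_bigsetU.
  apply: nearW => N; apply: (@csm_one_sided_bound _ _ _ _ _ p _ _ _ false) => //.
    move=> n k n0; rewrite ltr_pdivlMr ?ltr0n // => nk.
    by rewrite mulr_le0_ge0 ?subr_le0 // subr_ge0 mulrC ltW.
  by move=> n n0; rewrite mul0r ltNge (ltW a0).
set E := [set _ | _].
have mE : measurable E.
  rewrite (_ : E = ~` [set w | alpha < csm_estimator alpha eps (X^~ w)]).
    by apply: measurableC; rewrite csm_estimator_gtE; exact: bigcup_measurable.
  by apply/seteqP; split => w; rewrite /E /= leNgt => /negP.
pose bad n k := k%:R / n%:R <= alpha.
pose rho := Num.sqrt (p * alpha) + Num.sqrt ((1 - p) * (1 - alpha)).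
have rho1 : 0 <= rho < 1.
  rewrite addr_ge0 ?sqrtr_ge0 //= hellinger_affinity_lt1 // ?gt_eqF //.
  by rewrite !ltW.
have K0 : (N.+1%:R / eps * rho ^+ N) @[N --> \oo] --> 0.
  under eq_fun do rewrite mulrAC.
  by rewrite -[0](mul0r eps^-1); apply: cvgMl; exact: cvg_natmul_expr0.
(* The slack [e] absorbs the probability that the rule fails at a large time [N]. *)
apply/lee_addgt0Pr => e epos.
have /cvgr_le /(_ _ epos) Kle := K0.
near \oo => N.
have N0 : (0 < N)%N by near: N; exists 1%N.
have KN : N.+1%:R / eps * rho ^+ N <= e by near: N.
pose W : set T := \big[setU/set0]_(n < N.+1) csm_stopped alpha eps X bad n.
pose Z := [set w | ~~ csm_stop alpha eps (X^~ w) N].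
have mW : measurable W.
  by apply: bigsetU_measurable => n _; exact: measurable_csm_stopped.
have mZ : measurable Z by exact: measurable_csm_stop.
(* If the rule holds at [N], then [tau <= N] and the error lies in [W], whose union includes time
   [N]; otherwise the outcome is in [Z]. *)
apply: (@le_trans _ _ (P p (W `|` Z))).
  apply: le_measure; rewrite ?inE //; first exact: measurableU.
  move=> w; rewrite /E /Z /csm_estimator /=.
  have [st|nst] := boolP (csm_stop alpha eps (X^~ w) N); last by right.
  case tau : csm_tau => [n|].
    left; rewrite /W -bigcup_mkord; exists n => //=.
    by have [_ /(_ _ st)] := (csm_tauP _ _ _ _).1 tau.
  by move: tau; rewrite /csm_tau; case: pselect => // -[]; exists N.
apply: (le_trans (measureU2 _ mW mZ)); apply: leeD.
  (* The all-successes path has frequency [1 > alpha], so it never errs on this side. *)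
  apply: (@csm_one_sided_bound _ _ _ _ _ p _ _ _ true) => //.
    move=> n k n0; rewrite /bad ler_pdivrMr ?ltr0n // => nk.
    by rewrite mulr_ge0_le0 // ?subr_ge0 ?subr_le0 1?mulrC // ltW.
  by move=> n n0; rewrite /bad divff ?pnatr_eq0 -?lt0n // leNgt a1.
by apply: (le_trans (csm_not_stop_bound _ _ _ _ _ _ p01 halpha heps PC N0)); rewrite lee_fin.
Unshelve. all: by end_near. Qed.
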